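(* Let $K$ be a field, and let $m_0<m_1<m_2<m_3$ be positive integers with $\gcd=1$, $m_i=m_0+id$ ($d>0$), minimally generating the numerical semigroup they generate. Write $m_0=3a+b$ with integers $a\ge 1$ and $b\in\{1,2,3\}$. Let $S=R_b[t]$ and let $\mathfrak{a}_b\subseteq S$ be the ideal generated by the polynomials $P(i,j)$ ($i,j\in\{1,2\}$) and $P(\Psi(b,l))$ ($l\in[0,3-b]$). Then, with respect to the monomial order $>_{\mathcal E}$ on $S$, a Gröbner basis of $\mathfrak{a}_b$ is the set consisting of: all $P(i,j)$ ($i,j\in\{1,2\}$); all $P(\Psi(b,l))$ ($l\in[0,3-b]$); all $M(b,j)$ ($j\in[0,2-b]$, only when $b\ne 3$); $L(0),L(1)$; all $B(i,j)$ ($i,j\in\{1,2\}$); all $A(i;b,j)$ ($i\in\{1,2,3\}$, $j\in[0,2-b]$, only when $b\neq 3$); $D$; and the $Q(b,i)$, namely $Q(1,1),Q(1,2)$ if $b=1$, $Q(2,1)$ if $b=2$, and none if $b=3$.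
   Context: Notation: $[u,v]=\{n\in\mathbb{Z}: u\le n\le v\}$. $R=K[X_0,X_1,X_2,X_3]$. For $i,j\in\{1,2\}$ let $\epsilon(i,j)=i+j$ if $i+j<3$ and $\epsilon(i,j)=3$ if $i+j\ge 3$, and $\phi(i,j)=X_iX_j-X_{\epsilon(i,j)}X_{i+j-\epsilon(i,j)}$; explicitly $\phi(1,1)=X_1^2-X_2X_0$, $\phi(1,2)=\phi(2,1)=X_1X_2-X_3X_0$, $\phi(2,2)=X_2^2-X_1X_3$. For $j\in[0,3-b]$ let $\psi(b,j)=X_{b+j}X_3^a-X_jX_0^{a+d}$. $R_b=K[X_1,X_2,X_3,X_0,\Psi(b,0),\dots,\Psi(b,3-b),\Phi(2,2),\Phi(1,2),\Phi(1,1)]$ is a polynomial ring in these indeterminates, and $S=R_b[t]$ with $t$ a further indeterminate. Conventions: $\Phi(i,j)=\Phi(j,i)$; $\Phi(i,j)=0$ if $i\notin\{1,2\}$ or $j\notin\{1,2\}$; $\Psi(b,j)=0$ if $j\notin[0,3-b]$; $X_i=0$ if $i\notin[0,3]$. Monomial order $>_{\mathcal E}$: a monomial of $S$ is $t^k X_1^{\alpha_1}X_2^{\alpha_2}X_3^{\alpha_3}X_0^{\alpha_0}\prod_{i=0}^{3-b}\Psi(b,i)^{\beta_i}\,\Phi(2,2)^{\gamma_1}\Phi(1,2)^{\gamma_2}\Phi(1,1)^{\gamma_3}$, with $\alpha=(\alpha_1,\alpha_2,\alpha_3,\alpha_0)$, $\beta=(\beta_0,\dots,\beta_{3-b})$,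 $\gamma=(\gamma_1,\gamma_2,\gamma_3)$. Define the additive weight $\omega$ on $t$-free monomials by $\omega(X_i)=m_i$, $\omega(\Phi(i,j))=m_i+m_j$, $\omega(\Psi(b,j))=am_3+m_{b+j}$. Then $t^k\mathbb{X}^\alpha\Psi^\beta\Phi^\gamma>_{\mathcal E}t^{k'}\mathbb{X}^{\alpha'}\Psi^{\beta'}\Phi^{\gamma'}$ iff the first applicable condition holds: (i) $k>k'$; (ii) $k=k'$ and $\omega(\mathbb{X}^\alpha\Psi^\beta\Phi^\gamma)>\omega(\mathbb{X}^{\alpha'}\Psi^{\beta'}\Phi^{\gamma'})$; (iii) equal so far and $\sum\beta_i>\sum\beta'_i$; (iv) equal so far, $\sum\beta_i=\sum\beta'_i$, and the rightmost nonzero entry of $\beta-\beta'$ is negative; (v) $\beta=\beta'$ and $\sum\gamma_i>\sum\gamma'_i$; (vi) $\beta=\beta'$, $\sum\gamma_i=\sum\gamma'_i$ and the rightmost nonzero entry of $\gamma-\gamma'$ is negative; (vii) $\beta=\beta'$, $\gamma=\gamma'$ and the rightmost nonzero entry of $\alpha-\alpha'$ is negative (in (v)–(vii) also $k=k'$ and equal weights). Polynomials: $P(i,j)=t\,\phi(i,j)-\Phi(i,j)$ for $i,j\in\{1,2\}$; $P(\Psi(b,l))=tX_{b+l}X_3^a-tX_lX_0^{a+d}-\Psi(b,l)$ for $l\in[0,3-b]$; $D=(X_1^2-X_2X_0)\Phi(1,2)-(X_1X_2-X_3X_0)\Phi(1,1)$; $B(i,j)=\phi(i,j)\Psi(b,3-b)-(X_3^{a+1}-X_{3-b}X_0^{a+d})\Phi(i,j)$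 for $i,j\in\{1,2\}$; $L(i)=X_i\Phi(2,2)-X_{i+1}\Phi(1,2)+X_{i+2}\Phi(1,1)$ for $i\in\{0,1\}$; for $b\ne 3$, $i\in\{1,2,3\}$, $j\in[0,2-b]$ (with $\epsilon(u,v)=u+v$ if $u+v<3$, $=3$ otherwise): $A(i;b,j)=X_i\Psi(b,j)-X_{b+i+j-\epsilon(i,b+j)}\Psi(b,\epsilon(i,b+j)-b)-X_3^a\Phi(i,b+j)+X_0^{a+d}[\Phi(i,j)-\Phi(b+i+j-3,3-b)]$; for $b\ne3$, $i\in[0,2-b]$: $M(b,i)=tX_0^{a+d+1}\Psi(b,i)+\Psi(b,0)\Psi(b,i)-tX_3^{a-1}X_{1+b+i}X_{b-1}\Psi(b,3-b)-tX_3^{2a}\Phi(b,b+i)+(-1)^{i+1}tX_3^{a-1}X_0^{a+d}X_{3b+3i-3}\Phi(3-b-i,3-b-i)$; $Q(1,1)=\Psi(1,0)\Phi(2,2)+\Psi(1,2)\Phi(1,1)-\Psi(1,1)\Phi(1,2)$; $Q(1,2)=\Psi(1,1)^2-\Psi(1,2)\Psi(1,0)-X_3^{a-1}\Psi(1,2)\Phi(2,2)+X_0^{a+d-1}\Psi(1,0)\Phi(1,1)-X_3^{a-1}X_0^{a+d-1}(\Phi(1,2)^2-\Phi(2,2)\Phi(1,1))$; $Q(2,1)=\Psi(2,0)^2\Phi(2,2)-X_3^{a-1}\Psi(2,1)\Phi(2,2)^2-\Psi(2,1)\Psi(2,0)\Phi(1,2)-X_3^{a-1}X_0^{a+d-1}\Phi(1,2)^3+\Psi(2,1)^2\Phi(1,1)+X_3^{a-1}X_0^{a+d-1}\Phi(2,2)\Phi(1,2)\Phi(1,1)+X_0^{a+d-1}\Psi(2,0)\Phi(1,1)^2$.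 *)

(* Defs.v *)
From HB Require Import structures.
From mathcomp Require Import all_boot all_order all_algebra.
From mathcomp Require Import mpoly.
Set Implicit Arguments. Unset Strict Implicit. Unset Printing Implicit Defensive.
Import Order.TTheory GRing.Theory Num.Theory.

Definition mseq (m0 d i : nat) : nat := (m0 + i * d)%N.

Definition in_monoid (gs : seq nat) (x : nat) : Prop :=
  exists cs : seq nat, size cs = size gs /\
    x = (\sum_(k < size gs) nth 0 cs k * nth 0 gs k)%N.

Definition minimally_generating (m : nat -> nat) : Prop :=
  forall i, (i < 4)%N -> ~ in_monoid [seq m j | j <- iota 0 4 & j != i] (m i).

(* Variables of S (12 - b of them), indexed as:
   X1 -> 0, X2 -> 1, X3 -> 2, X0 -> 3, Psi(b,j) -> 4 + j (j in [0,3-b]),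
   Phi(2,2) -> 8 - b, Phi(1,2) -> 9 - b, Phi(1,1) -> 10 - b, t -> 11 - b. *)
Definition nv (b : nat) : nat := (12 - b)%N.

Local Open Scope ring_scope.

Section Polys.
Variables (K : fieldType) (b a d : nat).
Notation S := {mpoly K[nv b]}.

Definition mv (k : nat) : S :=
  if (insub k : option 'I_(nv b)) is Some i then 'X_i else 0.

Definition Xn (k : nat) : S :=
  match k with 0 => mv 3 | 1 => mv 0 | 2 => mv 1 | _ => mv 2 end.

Definition Xv (i : int) : S := if (0 <= i <= 3) then Xn `|i|%N else 0.

Definition Psi (j : int) : S :=
  if (0 <= j) && (`|j|%N <= 3 - b)%N then mv (4 + `|j|)%N else 0.

Definition Phi (i j : int) : S :=
  if (i == 1) && (j == 1) then mv (10 - b)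
  else if ((i == 1) && (j == 2)) || ((i == 2) && (j == 1)) then mv (9 - b)
  else if (i == 2) && (j == 2) then mv (8 - b)
  else 0.

Definition tv : S := mv (11 - b).

Definition eps (u v : int) : int := if u + v < 3 then u + v else 3.

Definition phi (i j : int) : S :=
  Xv i * Xv j - Xv (eps i j) * Xv (i + j - eps i j).

Definition X0 := Xv 0. Definition X1 := Xv 1.
Definition X2 := Xv 2. Definition X3 := Xv 3.
Definition bz : int := b%:Z.

Definition Ppoly (i j : int) : S := tv * phi i j - Phi i j.

Definition PPsi (l : int) : S :=
  tv * Xv (bz + l) * X3 ^+ a - tv * Xv l * X0 ^+ (a + d) - Psi l.

Definition Dpoly : S :=
  (X1 ^+ 2 - X2 * X0) * Phi 1 2 - (X1 * X2 - X3 * X0) * Phi 1 1.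

Definition Bpoly (i j : int) : S :=
  phi i j * Psi (3 - bz) - (X3 ^+ (a + 1) - Xv (3 - bz) * X0 ^+ (a + d)) * Phi i j.

Definition Lpoly (i : int) : S :=
  Xv i * Phi 2 2 - Xv (i + 1) * Phi 1 2 + Xv (i + 2) * Phi 1 1.

Definition Apoly (i j : int) : S :=
  Xv i * Psi j
  - Xv (bz + i + j - eps i (bz + j)) * Psi (eps i (bz + j) - bz)
  - X3 ^+ a * Phi i (bz + j)
  + X0 ^+ (a + d) * (Phi i j - Phi (bz + i + j - 3) (3 - bz)).

Definition Mpoly (i : nat) : S :=
  tv * X0 ^+ (a + d + 1) * Psi i + Psi 0 * Psi i
  - tv * X3 ^+ (a - 1) * Xv (1 + bz + i%:Z) * Xv (bz - 1) * Psi (3 - bz)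
  - tv * X3 ^+ (2 * a) * Phi bz (bz + i%:Z)
  + (-1) ^+ (i + 1) * tv * X3 ^+ (a - 1) * X0 ^+ (a + d)
      * Xv (3 * bz + 3 * i%:Z - 3) * Phi (3 - bz - i%:Z) (3 - bz - i%:Z).

Definition Q11 : S := Psi 0 * Phi 2 2 + Psi 2 * Phi 1 1 - Psi 1 * Phi 1 2.

Definition Q12 : S :=
  Psi 1 ^+ 2 - Psi 2 * Psi 0 - X3 ^+ (a - 1) * Psi 2 * Phi 2 2
  + X0 ^+ (a + d - 1) * Psi 0 * Phi 1 1
  - X3 ^+ (a - 1) * X0 ^+ (a + d - 1) * (Phi 1 2 ^+ 2 - Phi 2 2 * Phi 1 1).

Definition Q21 : S :=
  Psi 0 ^+ 2 * Phi 2 2 - X3 ^+ (a - 1) * Psi 1 * Phi 2 2 ^+ 2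
  - Psi 1 * Psi 0 * Phi 1 2
  - X3 ^+ (a - 1) * X0 ^+ (a + d - 1) * Phi 1 2 ^+ 3
  + Psi 1 ^+ 2 * Phi 1 1
  + X3 ^+ (a - 1) * X0 ^+ (a + d - 1) * Phi 2 2 * Phi 1 2 * Phi 1 1
  + X0 ^+ (a + d - 1) * Psi 0 * Phi 1 1 ^+ 2.

Definition gens_ab : seq S :=
  [:: Ppoly 1 1; Ppoly 1 2; Ppoly 2 1; Ppoly 2 2]
  ++ [seq PPsi l%:Z | l <- iota 0 (4 - b)].

Definition GB_ab : seq S :=
  [:: Ppoly 1 1; Ppoly 1 2; Ppoly 2 1; Ppoly 2 2]
  ++ [seq PPsi l%:Z | l <- iota 0 (4 - b)]
  ++ (if b != 3%N then [seq Mpoly j | j <- iota 0 (3 - b)] else [::])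
  ++ [:: Lpoly 0; Lpoly 1]
  ++ [:: Bpoly 1 1; Bpoly 1 2; Bpoly 2 1; Bpoly 2 2]
  ++ (if b != 3%N then
        [seq Apoly i%:Z j%:Z | i <- [:: 1%N; 2%N; 3%N], j <- iota 0 (3 - b)]
      else [::])
  ++ [:: Dpoly]
  ++ (if b == 1%N then [:: Q11; Q12] else if b == 2%N then [:: Q21] else [::]).

End Polys.

Section Order.
Variables (b a m0 d : nat).
Notation n := (nv b).
Notation m := (mseq m0 d).

Definition ex (mu : 'X_{1..n}) (k : nat) : nat :=
  if (insub k : option 'I_n) is Some i then mu i else 0%N.

Definition alpha (mu : 'X_{1..n}) : seq nat := [:: ex mu 0; ex mu 1; ex mu 2; ex mu 3].
Definition beta (mu : 'X_{1..n}) : seq nat := [seq ex mu (4 + j) | j <- iota 0 (4 - b)].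
Definition gamma (mu : 'X_{1..n}) : seq nat := [:: ex mu (8 - b); ex mu (9 - b); ex mu (10 - b)].
Definition tdeg (mu : 'X_{1..n}) : nat := ex mu (11 - b).

Definition omega (mu : 'X_{1..n}) : nat :=
  (m 1 * ex mu 0 + m 2 * ex mu 1 + m 3 * ex mu 2 + m 0 * ex mu 3
   + \sum_(j <- iota 0 (4 - b)) (a * m 3 + m (b + j)) * ex mu (4 + j)
   + (m 2 + m 2) * ex mu (8 - b) + (m 1 + m 2) * ex mu (9 - b)
   + (m 1 + m 1) * ex mu (10 - b))%N.

Fixpoint first_lt (s s' : seq nat) : bool :=
  match s, s' with
  | x :: s1, y :: s2 => if x == y then first_lt s1 s2 else (x < y)%N
  | _, _ => false
  end.

(* the rightmost nonzero entry of s - s' is negative *)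
Definition rightmost_neg (s s' : seq nat) : bool := first_lt (rev s) (rev s').

Definition mono_gtE (mu mu' : 'X_{1..n}) : bool :=
  let k := tdeg mu in let k' := tdeg mu' in
  let w := omega mu in let w' := omega mu' in
  let be := beta mu in let be' := beta mu' in
  let ga := gamma mu in let ga' := gamma mu' in
  [|| (k > k')%N,
      (k == k') && (w > w')%N,
      [&& k == k', w == w' & (sumn be > sumn be')%N],
      [&& k == k', w == w', sumn be == sumn be' & rightmost_neg be be'],
      [&& k == k', w == w', be == be' & (sumn ga > sumn ga')%N],
      [&& k == k', w == w', be == be', sumn ga == sumn ga' & rightmost_neg ga ga'] |
      [&& k == k', w == w', be == be', ga == ga' & rightmost_neg (alpha mu) (alpha mu')]].
End Order.

Section Groebner.
Variables (K : fieldType) (n : nat) (gt : 'X_{1..n} -> 'X_{1..n} -> bool).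

Definition is_lead_mon (f : {mpoly K[n]}) (mu : 'X_{1..n}) : Prop :=
  mu \in msupp f /\ forall nu, nu \in msupp f -> nu != mu -> gt mu nu.

Definition mon_divides (mu nu : 'X_{1..n}) : bool := [forall i, (mu i <= nu i)%N].

Definition in_ideal (gens : seq {mpoly K[n]}) (f : {mpoly K[n]}) : Prop :=
  exists c : nat -> {mpoly K[n]}, f = \sum_(i < size gens) c i * gens`_i.

Definition is_groebner_basis (G gens : seq {mpoly K[n]}) : Prop :=
  (forall g, g \in G -> in_ideal gens g) /\
  (forall f, in_ideal gens f -> f != 0 ->
     exists g, exists muf, exists mug,
       [/\ g \in G, is_lead_mon f muf, is_lead_mon g mug & mon_divides mug muf]).
End Groebner.

Arguments mono_gtE : clear implicits.

(* Main.v *)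
Require Import Defs.
From HB Require Import structures.
From mathcomp Require Import all_boot all_order all_algebra.
From mathcomp Require Import mpoly ring zify.
Set Implicit Arguments. Unset Strict Implicit. Unset Printing Implicit Defensive.
Import Order.TTheory GRing.Theory Num.Theory.
Local Open Scope ring_scope.

(* Let sigma be the endomorphism of S fixing t and the X_i and sending Phi to
   t phi and Psi to t psi: the ideal a_b is its kernel, so membership in a_b is a
   polynomial identity.  The elements of the basis are homogeneous for both omega
   and the degree tau in t, Phi, Psi.  Call a monomial standard if no leading
   monomial of the basis divides it; in each bidegree the images of the standard
   monomials span the multiples t^n X^alpha.  If the leading monomial of some f in
   the kernel were standard, the other standard monomials would already span.  This
   contradicts a count: standard monomials inject, preserving the bidegree, into the
   monomials t^n X^alpha.  The injection trades the factors Phi and Psi one at a time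
   for t times monomials in X; no S-polynomial is ever computed. *)

(** Well-foundedness comes from the finite list: the number of entries of [E] below [x] drops
    strictly. *)
Lemma finite_gt_ind (T : eqType) (gt : rel T) (E : seq T) (P : T -> Prop) :
  irreflexive gt -> transitive gt ->
  (forall x, x \in E -> (forall y, y \in E -> gt x y -> P y) -> P x) ->
  forall x, x \in E -> P x.
Proof.
move=> gt_irr gt_trans IH x; have [k] := ubnP (count (gt x) E).
elim: k x => // k IHk x lt_k xE; apply: IH => // y yE gt_xy; apply: IHk => //.
rewrite ltnS in lt_k; apply: leq_trans lt_k.
(* Everything below [y], and [y] itself, lies below [x], while [y] is not below itself. *)
have sub : subpred (predU (gt y) (pred1 y)) (gt x).
  by move=> z /orP[/(gt_trans _ _ _ gt_xy)|/eqP->].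
apply: leq_trans (sub_count sub E); rewrite -[leqRHS]addn0.
have <- : count (predI (gt y) (pred1 y)) E = 0%N.
  apply/eqP; rewrite -leqn0 leqNgt -has_count; apply/hasP => -[z _ /andP[gt_yz /eqP zy]].
  by rewrite zy gt_irr in gt_yz.
by rewrite count_predUI -addn1 leq_add2l lt0n; apply/eqP/count_memPn/negP; rewrite yE.
Qed.

(** * A rank argument *)

Section StandardMonomials.
Variables (K : fieldType) (n : nat) (gt : rel 'X_{1..n}).
Notation S := {mpoly K[n]}.
Hypotheses (gt_irr : irreflexive gt) (gt_trans : transitive gt).

Definition reduces_to (E : seq 'X_{1..n}) (mu : 'X_{1..n}) (r : S) :=
  forall nu, nu \in msupp r -> (nu \in E) && gt mu nu.

(** Later [E] is a finite box of bidegrees, [tgt] selects the monomials in t and the X_i, and [h]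
    trades away all factors Phi and Psi. *)
Variable sigma : {linear S -> S}.
Variables (E : seq 'X_{1..n}) (std tgt : pred 'X_{1..n}) (h : 'X_{1..n} -> 'X_{1..n}).
Hypothesis reducible : forall nu, nu \in E -> ~~ std nu ->
  exists2 r, sigma 'X_[nu] = sigma r & reduces_to E nu r.
Hypothesis sigma_tgt : forall nu, tgt nu -> sigma 'X_[nu] = 'X_[nu].
Hypothesis tgtE : forall nu, nu \in E -> std nu -> (h nu \in E) && tgt (h nu).
Hypothesis h_inj : {in [pred nu in E | std nu] &, injective h}.

Let spanned (A : seq 'X_{1..n}) (p : S) :=
  exists c : 'X_{1..n} -> K, sigma p = \sum_(m <- A) c m *: sigma 'X_[m].

Lemma spanned_supp A p : (forall m, m \in msupp p -> spanned A 'X_[m]) -> spanned A p.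
Proof.
move=> spm; rewrite /spanned (mpolyE p) linear_sum.
elim: (msupp p) spm => [|m s IHs] spm.
  by exists (fun=> 0); rewrite big_nil big1 // => m _; rewrite scale0r.
have [x xs|c Ec] := IHs; first by apply: spm; rewrite inE xs orbT.
have [|c' Ec'] := spm m; first by rewrite inE eqxx.
exists (fun x => p@_m * c' x + c x).
rewrite big_cons Ec linearZ /= Ec' scaler_sumr -big_split /=.
by apply: eq_bigr => x _; rewrite scalerDl scalerA.
Qed.

(** Were [mu] standard, [f] would reduce [mu] as well, and the other standard monomials [A] would
    span the images of all of [E], among them the linearly independent targets [T]. But [h] shows
    that [T] is larger than [A]. *)
Lemma lead_mon_nonstd f mu : sigma f = 0 -> {subset msupp f <= E} ->
  is_lead_mon gt f mu -> ~~ std mu.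
Proof.
move=> sf0 fE [muf lead_mu]; apply/negP => std_mu.
have muE := fE _ muf.
pose A := [seq x <- undup E | std x && (x != mu)].
pose T := [seq x <- undup E | tgt x].
have ltAT : (size A < size T)%N.
  have -> : (size A).+1 = size (map h (mu :: A)) by rewrite size_map.
  have inE' x : x \in mu :: A -> x \in [pred nu in E | std nu].
    rewrite in_cons mem_filter mem_undup => /predU1P[->|/andP[/andP[sx _] xE]].
      by apply/andP.
    by apply/andP.
  apply: uniq_leq_size.
    rewrite map_inj_in_uniq => [|x y xE yE]; last by apply: h_inj; exact: inE'.
    by rewrite cons_uniq mem_filter eqxx andbF /= filter_uniq ?undup_uniq.
  move=> y /mapP[x /inE' /andP[xE sx] ->].
  by rewrite mem_filter mem_undup andbC tgtE.
have span_all x : x \in E -> spanned A 'X_[x].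
  move: x; apply: (@finite_gt_ind _ gt) => // x xE IH.
  have [xA|xA] := boolP (x \in A).
    exists (fun y => (y == x)%:R); rewrite (bigD1_seq x) ?filter_uniq ?undup_uniq //=.
    by rewrite eqxx scale1r big1 ?addr0 // => y /negPf->; rewrite scale0r.
  have [r Er Hr] : exists2 r, sigma 'X_[x] = sigma r & reduces_to E x r.
    move: xA; rewrite mem_filter mem_undup xE andbT negb_and negbK.
    move=> /orP[/reducible|/eqP->]; first exact.
    have fmu0 : f@_mu != 0 by rewrite mcoeff_msupp in muf.
    (* Minus the tail of [f], with [f] made monic: it has the same image as the monomial [mu]
       because [sigma f = 0]. *)
    exists ('X_[mu] - (f@_mu)^-1 *: f).
      by rewrite linearB linearZ /= sf0 scaler0 subr0.
    move=> nu; rewrite mcoeff_msupp mcoeffB mcoeffX mcoeffZ.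
    have [<-|nmu] := eqVneq mu nu; first by rewrite mulVf // subrr eqxx.
    rewrite sub0r oppr_eq0 mulf_eq0 negb_or => /andP[_ nuf].
    by rewrite -mcoeff_msupp in nuf; rewrite fE // lead_mu // eq_sym.
  have [|c Ec] := @spanned_supp A r; last by exists c; rewrite Er.
  by move=> m /Hr/andP[mE gtm]; apply: IH.
have /fin_all_exists[c Ec] (i : 'I_(size T)) : exists c : 'X_{1..n} -> K,
    'X_[nth mu T i] = \sum_(m <- A) c m *: sigma 'X_[m].
  have: nth mu T i \in T by rewrite mem_nth.
  rewrite mem_filter mem_undup => /andP[tT TE].
  by have [c] := span_all _ TE; rewrite sigma_tgt //; exists c.
(* [C] expresses the targets by the images of A, [D] reads off their coefficients. *)
pose C := \matrix_(i < size T, j < size A) c i (nth mu A j).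
pose D := \matrix_(j < size A, i < size T) (sigma 'X_[nth mu A j])@_(nth mu T i).
have CD : C *m D = 1%:M.
  apply/matrixP => i i'; rewrite !mxE.
  have := congr1 (mcoeff (nth mu T i')) (Ec i).
  rewrite mcoeffX nth_uniq ?filter_uniq ?undup_uniq // linear_sum /= => ->.
  rewrite (big_nth mu) big_mkord; apply: eq_bigr => j _.
  by rewrite !mxE mcoeffZ.
(* An identity matrix of size [size T] cannot factor through the smaller dimension [size A]. *)
have := mxrankM_maxl C D; rewrite CD mxrank1 => /leq_trans/(_ (rank_leq_col C)).
by rewrite leqNgt ltAT.
Qed.
End StandardMonomials.

(** * Lexicographic comparison *)

Fixpoint lexgt (s s' : seq int) : bool :=
  match s, s' with
  | x :: s1, y :: s2 => if x == y then lexgt s1 s2 else y < x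
  | _, _ => false
  end.

Lemma lexgt_irr : irreflexive lexgt.
Proof. by elim=> //= x s IHs; rewrite eqxx. Qed.

Lemma lexgt_trans : transitive lexgt.
Proof.
elim=> [|y s IHs] [|x s1] [|z s2] //=.
have [<-|nxy] := eqVneq x y.
  by have [_|//] := eqVneq x z; exact: IHs.
have [<-|_] := eqVneq y z; first by rewrite (negPf nxy).
by move=> lt_yx lt_zy; have lt_zx := lt_trans lt_zy lt_yx; rewrite gt_eqF.
Qed.

Lemma lexgt_total s s' : size s = size s' -> s != s' -> lexgt s s' || lexgt s' s.
Proof.
elim: s s' => [|x s IHs] [|y s'] //= [/IHs{}IHs]; rewrite eqseq_cons.
by case: ltgtP => // _; exact: IHs.
Qed.

Lemma lexgt_cat s1 s1' s2 s2' : size s1 = size s1' ->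
  lexgt (s1 ++ s2) (s1' ++ s2') = lexgt s1 s1' || (s1 == s1') && lexgt s2 s2'.
Proof.
elim: s1 s1' => [|x s1 IHs] [|y s1'] //= [/IHs{}IHs]; rewrite eqseq_cons.
by case: eqVneq => //= _; rewrite orbF.
Qed.

Lemma first_lt_lexgt s s' : size s = size s' ->
  first_lt s s' = lexgt [seq - (x : nat)%:Z | x <- s] [seq - (x : nat)%:Z | x <- s'].
Proof.
elim: s s' => [|x s IHs] [|y s'] //= [/IHs->].
by rewrite eqr_opp eqz_nat ltrN2 ltz_nat.
Qed.

Definition add_seq (s s' : seq int) := [seq p.1 + p.2 | p <- zip s s'].

(** This translation invariance makes the monomial order multiplicative. *)
Lemma lexgt_add s s' c : size s = size s' -> size c = size s ->
  lexgt (add_seq s c) (add_seq s' c) = lexgt s s'.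
Proof.
elim: s s' c => [|x s IHs] [|y s'] [|z c] //= [ss'] [cs].
by rewrite (inj_eq (addIr z)) ltrD2r IHs.
Qed.

(** * The weight-preserving injection *)

(* Exponents of a t-free monomial: [p_i] is the exponent of Psi(b, i - b), so that
   its weight a m_3 + m_i does not depend on b ([p_i = 0] for i < b), and [f_ij] is
   the exponent of Phi(i, j). *)
Record tfree := TFree
  { x1 : nat; x2 : nat; x3 : nat; x0 : nat; p1 : nat; p2 : nat; p3 : nat;
    f22 : nat; f12 : nat; f11 : nat }.

Section Shift.
Variables (b a d : nat).

Definition tfdeg u := (p1 u + p2 u + p3 u + f22 u + f12 u + f11 u)%N.

Definition weight u :=
  let m := mseq (3 * a + b) d in
  (m 1 * x1 u + m 2 * x2 u + m 3 * x3 u + m 0 * x0 u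
   + (a * m 3 + m 1) * p1 u + (a * m 3 + m 2) * p2 u + (a * m 3 + m 3) * p3 u
   + (m 2 + m 2) * f22 u + (m 1 + m 2) * f12 u + (m 1 + m 1) * f11 u)%N.

(** The clauses exclude, in order, the leading monomials of B, of A, of L, of D, and of the Q for b
    = 1 and b = 2. The last two also record that [p_i = 0] for i < b. *)
Definition tfree_std u : bool :=
  [&& (0 < p3 u) ==> (x1 u + x2 u <= 1),
      (0 < p1 u + p2 u) ==> (x1 u + x2 u + x3 u == 0),
      (0 < f22 u) ==> (x0 u + x1 u == 0),
      (0 < f12 u) ==> (x1 u <= 1),
      (b == 1) ==> (p2 u <= 1) && ((0 < p1 u) ==> (f22 u == 0)),
      (b == 2) ==> (p1 u == 0) && ((1 < p2 u) ==> (f22 u == 0)) &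
      (b == 3) ==> (p1 u + p2 u == 0)]%N.

(* Standardness of t * u, given that of u. *)
Definition t_std u : bool :=
  [&& x1 u + x2 u <= 1, x3 u <= a,
      (a <= x3 u) && (b <= 2) ==> (x2 u == 0),
      (a <= x3 u) && (b == 1) ==> (x1 u == 0) &
      (0 < p1 u + p2 u) ==> (x0 u <= a + d)]%N.

(* One factor Phi or Psi is traded for a monomial of the same weight, namely a
   leading monomial of the phi or psi it stands for, with two exceptions.  When
   several Psi(b, l) with l < 3 - b are present, one becomes X_0^(a+d+1), the
   cofactor of t Psi(b, j) in the leading monomial of M(b, j); and X_1 Phi(1,2) becomes
   X_0 X_2^2, as X_1^2 X_2 already arises from X_2 Phi(1,1). *)
Definition shift u : tfree :=
  let: TFree x1 x2 x3 x0 p1 p2 p3 f22 f12 f11 := u in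
  (if 1 < p1 + p2 then
    if b == 1 then TFree x1 x2 x3 (x0 + a + d + 1) p1.-1 p2 p3 f22 f12 f11
    else TFree x1 x2 x3 (x0 + a + d + 1) p1 p2.-1 p3 f22 f12 f11
  else if 0 < p1 then TFree x1.+1 x2 (x3 + a) x0 p1.-1 p2 p3 f22 f12 f11
  else if 0 < p2 then TFree x1 x2.+1 (x3 + a) x0 p1 p2.-1 p3 f22 f12 f11
  else if 0 < p3 then TFree x1 x2 (x3 + a).+1 x0 p1 p2 p3.-1 f22 f12 f11
  else if 0 < f22 then TFree x1 x2.+2 x3 x0 p1 p2 p3 f22.-1 f12 f11
  else if f12 == 0 then TFree x1.+2 x2 x3 x0 p1 p2 p3 f22 f12 f11.-1
  else if x1 == 0 then TFree x1.+1 x2.+1 x3 x0 p1 p2 p3 f22 f12.-1 f11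
  else TFree x1.-1 x2.+2 x3 x0.+1 p1 p2 p3 f22 f12.-1 f11)%N.

Hypothesis b_in : b \in [:: 1; 2; 3]%N.

(** On a standard monomial the result of [shift] shows which trade was made. A factor counted by p1
    or p2 survives only the trade for X_0^(a+d+1). Otherwise [x1 + x2 <= 1] marks a trade of some
    Psi, identified by x3 and x1, and [x1 + x2 > 1] a trade of some Phi, identified by x1 and, if x1
    = 0, by x0: Phi(2,2) leaves x0 = 0, while X_1 Phi(1,2) leaves x0 > 0. *)
Let unshift (u : tfree) : tfree :=
  let: TFree x1 x2 x3 x0 p1 p2 p3 f22 f12 f11 := u in
  (if 0 < p1 + p2 then
    if b == 1 then TFree x1 x2 x3 (x0 - (a + d + 1)) p1.+1 p2 p3 f22 f12 f11
    else TFree x1 x2 x3 (x0 - (a + d + 1)) p1 p2.+1 p3 f22 f12 f11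
  else if x1 + x2 <= 1 then
    if a < x3 then TFree x1 x2 (x3 - a.+1) x0 p1 p2 p3.+1 f22 f12 f11
    else if 0 < x1 then TFree x1.-1 x2 (x3 - a) x0 p1.+1 p2 p3 f22 f12 f11
    else TFree x1 x2.-1 (x3 - a) x0 p1 p2.+1 p3 f22 f12 f11
  else if 1 < x1 then TFree x1.-2 x2 x3 x0 p1 p2 p3 f22 f12 f11.+1
  else if 0 < x1 then TFree x1.-1 x2.-1 x3 x0 p1 p2 p3 f22 f12.+1 f11
  else if x0 == 0 then TFree x1 x2.-2 x3 x0 p1 p2 p3 f22.+1 f12 f11
  else TFree x1.+1 x2.-2 x3 x0.-1 p1 p2 p3 f22 f12.+1 f11)%N.

Let shiftK u : tfree_std u -> (0 < tfdeg u)%N -> unshift (shift u) = u.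
Proof.
case: u => [x1 x2 x3 x0 p1 p2 p3 f22 f12 f11]; rewrite /tfree_std /tfdeg /shift /=.
move: b_in; rewrite /unshift !inE => /or3P[] /eqP-> /= Hs Hd;
  repeat (case: ifP => ? /=); try lia; congr TFree; lia.
Qed.

Lemma shift_inj u v : tfree_std u -> tfree_std v -> (0 < tfdeg u)%N ->
  (0 < tfdeg v)%N -> shift u = shift v -> u = v.
Proof. by move=> su sv du dv E; rewrite -(shiftK su du) E shiftK. Qed.

(** The monomial traded in makes t times the result divisible by a leading monomial of P or M, so
    [t_std] fails. The weight survives the trade for X_0^(a+d+1) because m_0 = 3a + b gives a m_3 +
    m_b = (a + d + 1) m_0. *)
Lemma shift_std u : tfree_std u -> (0 < tfdeg u)%N ->
  [/\ tfree_std (shift u), ~~ t_std (shift u), tfdeg u = (tfdeg (shift u)).+1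
    & weight (shift u) = weight u].
Proof.
case: u => [x1 x2 x3 x0 p1 p2 p3 f22 f12 f11].
rewrite /tfree_std /t_std /tfdeg /weight /shift /mseq /=.
move: b_in; rewrite !inE => /or3P[] /eqP-> /= Hs Hd;
  repeat (case: ifP => ? /=); try lia; split; try lia;
  repeat match goal with |- context [?p.-1] => is_var p; destruct p end; simpl; lia.
Qed.

Lemma iter_shift_std n u : tfree_std u -> (n <= tfdeg u)%N ->
  [/\ tfree_std (iter n shift u), tfdeg (iter n shift u) = (tfdeg u - n)%N
    & weight (iter n shift u) = weight u].
Proof.
move=> su; elim: n => [|n IHn] le_n /=; first by rewrite subn0.
have [su' Ed Ew] := IHn (ltnW le_n).
have [|-> _ Ed' ->] := shift_std su'; first by rewrite Ed subn_gt0.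
by split=> //; rewrite subnS -Ed Ed'.
Qed.

Lemma iter_shift_inj n u v : tfree_std u -> tfree_std v -> tfdeg u = n ->
  tfdeg v = n -> iter n shift u = iter n shift v -> u = v.
Proof.
elim: n u v => [//|n IHn] u v su sv du dv; rewrite !iterSr => E.
have [|su' _ du' _] := shift_std su; first by rewrite du.
have [|sv' _ dv' _] := shift_std sv; first by rewrite dv.
apply: shift_inj; rewrite ?du ?dv //; apply: IHn E => //; lia.
Qed.

Definition collapse u := iter (tfdeg u) shift u.

Lemma collapse_std u : tfree_std u ->
  [/\ tfree_std (collapse u), tfdeg (collapse u) = 0%N & weight (collapse u) = weight u].
Proof. by move=> su; have [] := iter_shift_std su (leqnn _); rewrite subnn. Qed.

(* The factors t separate monomials of different degrees: if the orbit of v runs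
   into u, then t * u is not standard. *)
Lemma collapse_inj k l u v : tfree_std u -> tfree_std v ->
  (0 < k)%N ==> t_std u -> (0 < l)%N ==> t_std v -> (k + tfdeg u = l + tfdeg v)%N ->
  collapse u = collapse v -> k = l /\ u = v.
Proof.
wlog le_uv : k l u v / (tfdeg u <= tfdeg v)%N => [W su sv tu tv E Euv|su sv tu _ E Euv].
  by case/orP: (leq_total (tfdeg u) (tfdeg v)) => /W H; [apply: H | case: (H l k)].
have [sv' dv' _] := iter_shift_std sv (leq_subr (tfdeg u) _).
(* Both sides are standard of the same degree and have the same collapse. *)
have Euv' : u = iter (tfdeg v - tfdeg u) shift v.
  apply: (@iter_shift_inj (tfdeg u)) => //; first by rewrite dv' subKn.
  by rewrite -iterD subnKC.
case Em: (tfdeg v - tfdeg u)%N Euv' => [|m] Euv'.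
  by move: E; rewrite Euv' /= => /addIn->.
have [||sw dw _] := @iter_shift_std m v; rewrite ?sv //; first lia.
have [|_ nt _ _] := shift_std sw; first by rewrite dw; lia.
(* Now [u] is a value of [shift], so t u is not standard and k = 0; but [tfdeg u < tfdeg v] forces k
   > 0. *)
move: tu; rewrite {1}Euv' iterS (negPf nt); case: k E => //; lia.
Qed.
End Shift.

(** * The monomial order *)

Section Exponents.
Variable b : nat.
Notation M := 'X_{1..nv b}.

Definition mk (k : nat) : M :=
  if (insub k : option 'I_(nv b)) is Some i then U_(i)%MM else 0%MM.

Lemma exE (mu : M) (i : 'I_(nv b)) : ex mu i = mu i.
Proof. by rewrite /ex valK. Qed.

Lemma exD (mu nu : M) k : ex (mu + nu)%MM k = (ex mu k + ex nu k)%N.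
Proof. by rewrite /ex; case: insub => // i; rewrite mnmDE. Qed.

Lemma exMn (mu : M) m k : ex (mu *+ m)%MM k = (ex mu k * m)%N.
Proof. by rewrite /ex; case: insub => // i; rewrite mulmnE. Qed.

Lemma ex_mk k j : (k < nv b)%N -> ex (mk k) j = (k == j) :> nat.
Proof.
move=> lt_k; have in_k := @insubT _ (fun x => x < nv b)%N 'I_(nv b) k lt_k.
rewrite /ex /mk in_k; case: insubP => [i _ <-|].
  by rewrite mnm1E.
by case: eqP => // <-; rewrite lt_k.
Qed.

Lemma ex_inj (mu nu : M) : (forall k, (k < nv b)%N -> ex mu k = ex nu k) -> mu = nu.
Proof. by move=> E; apply/mnmP => i; rewrite -!exE E. Qed.

Lemma mon_dividesE (mu nu : M) :
  mon_divides mu nu = all (fun k => ex mu k <= ex nu k)%N (iota 0 (nv b)).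
Proof.
apply/forallP/allP => [div k|div i]; last by rewrite -!exE div // mem_iota /=.
by rewrite mem_iota => lt_k; have := div (Ordinal lt_k); rewrite -!exE.
Qed.

(** Psi(b, i - b) has index 4 + i - b; for i < b that index belongs to an X variable, hence the two
    tests. *)
Definition encode (mu : M) : tfree :=
  TFree (ex mu 0) (ex mu 1) (ex mu 2) (ex mu 3)
    (if b <= 1 then ex mu (5 - b) else 0)%N (if b <= 2 then ex mu (6 - b) else 0)%N
    (ex mu (7 - b)) (ex mu (8 - b)) (ex mu (9 - b)) (ex mu (10 - b)).

(** Only collapsed monomials are decoded, so the exponents of Phi and Psi are left out. *)
Definition decode (k : nat) (u : tfree) : M :=
  (mk 0 *+ x1 u + mk 1 *+ x2 u + mk 2 *+ x3 u + mk 3 *+ x0 u + mk (11 - b) *+ k)%MM.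

Definition tau (mu : M) : nat := (tdeg mu + tfdeg (encode mu))%N.
End Exponents.

(** Once [b] is a numeral, equal indices become syntactically equal, and [lia] sees one atom per
    exponent. *)
Ltac eval_ex :=
  repeat match goal with
  | |- context [ex ?m (?x + ?y)%N] =>
      let k := eval vm_compute in (x + y)%N in change (ex m (x + y)%N) with (ex m k)
  | |- context [ex ?m (?x - ?y)%N] =>
      let k := eval vm_compute in (x - y)%N in change (ex m (x - y)%N) with (ex m k)
  end.

Lemma in123 b : b \in [:: 1; 2; 3]%N -> [\/ b = 1, b = 2 | b = 3]%N.
Proof. by rewrite !inE => /or3P[] /eqP; [constructor 1|constructor 2|constructor 3]. Qed.

Section MonomialOrder.
Variables (b a d : nat).
Notation M := 'X_{1..nv b}.
Notation omega := (omega a (3 * a + b) d).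
Notation gt := (mono_gtE b a (3 * a + b) d).

(* The negated exponents turn the reverse comparisons of the order into
   lexicographic ones. *)
Definition order_key (mu : M) : seq int :=
  [:: (tdeg mu)%:Z; (omega mu)%:Z; (sumn (beta mu))%:Z]
  ++ [seq - (x : nat)%:Z | x <- rev (beta mu)]
  ++ [:: (sumn (gamma mu))%:Z] ++ [seq - (x : nat)%:Z | x <- rev (gamma mu)]
  ++ [seq - (x : nat)%:Z | x <- rev (alpha mu)].

Lemma mono_gtE_key mu nu : gt mu nu = lexgt (order_key mu) (order_key nu).
Proof.
have oppz_inj : injective (fun x : nat => - x%:Z) by move=> x y; lia.
have : size (beta mu) = size (beta nu) by rewrite !size_map.
have : size (gamma mu) = size (gamma nu) by [].
have : size (alpha mu) = size (alpha nu) by [].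
rewrite /mono_gtE /rightmost_neg /order_key; move: (tdeg mu) (omega mu) (tdeg nu) (omega nu).
move: (beta mu) (beta nu) (gamma mu) (gamma nu) (alpha mu) (alpha nu).
move=> be be' ga ga' al al' k w k' w' sal sga sbe.
rewrite !lexgt_cat ?size_map ?size_rev // -!first_lt_lexgt ?size_rev //.
rewrite !(inj_eq (inj_map oppz_inj)) !(inj_eq (can_inj revK)) /= !eqseq_cons !eqz_nat !ltz_nat.
have [->|nbe] := eqVneq be be'; have [->|nga] := eqVneq ga ga';
  rewrite ?eqxx ?ltnn /= ?andbF ?andbT ?orbF;
  case: (ltngtP k k') => //= _; case: (ltngtP w w') => //= _;
  rewrite ?ltnn ?andbF //=; case: ltngtP => //=; rewrite ?andbF ?orbF.
Qed.

End MonomialOrder.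

Section MonomialOrderTheory.
Variables (b a d : nat).
Hypothesis b_in : b \in [:: 1; 2; 3]%N.
Notation M := 'X_{1..nv b}.
Notation gt := (mono_gtE b a (3 * a + b) d).
Notation omega := (omega a (3 * a + b) d).
Notation key := (@order_key b a d).

Lemma omegaE (mu : M) : omega mu = weight b a d (encode mu).
Proof.
by case: (in123 b_in) => E; subst b; rewrite /Defs.omega /weight /mseq unlock /=; eval_ex; lia.
Qed.

Lemma size_key (mu : M) : size (key mu) = (15 - b)%N.
Proof. by move: mu b_in => mu /in123[E|E|E]; move: mu; rewrite E. Qed.

(** Every entry of the key is linear in the exponents. *)
Lemma keyD (mu nu : M) : key (mu + nu)%MM = add_seq (key mu) (key nu).
Proof.
move: mu nu b_in => mu nu /in123[E|E|E]; move: mu nu; rewrite E => mu nu;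
rewrite /order_key /Defs.omega /alpha /beta /gamma /tdeg unlock /=; rewrite !exD /add_seq /=.
all: do !congr (_ :: _).
all: lia.
Qed.

Lemma key_inj : injective key.
Proof.
move: b_in => /in123[E|E|E]; rewrite E => mu nu; rewrite /order_key;
  rewrite /alpha /beta /gamma /tdeg /=; eval_ex; case=> *; apply: ex_inj; rewrite /nv;
  do 11? (case; first lia); move=> k; lia.
Qed.

Lemma gt_irr : irreflexive gt.
Proof. by move=> mu; rewrite mono_gtE_key lexgt_irr. Qed.

Lemma gt_trans : transitive gt.
Proof. by move=> nu mu xi; rewrite !mono_gtE_key; apply: lexgt_trans. Qed.

Lemma gt_total (mu nu : M) : mu != nu -> gt mu nu || gt nu mu.
Proof.
by move=> ne; rewrite !mono_gtE_key lexgt_total ?size_key // (inj_eq key_inj).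
Qed.

Lemma gt_add (mu nu xi : M) : gt mu nu -> gt (mu + xi)%MM (nu + xi)%MM.
Proof. by rewrite !mono_gtE_key !keyD lexgt_add ?size_key. Qed.

End MonomialOrderTheory.

(** * The substitution and its kernel *)

Section Substitution.
Variables (K : fieldType) (b a d : nat).
Notation S := {mpoly K[nv b]}.

Definition sigma_img (k : nat) : S :=
  if (4 <= k < 8 - b)%N then
    tv K b * (Xv K b (bz b + (k - 4)%N%:Z) * X3 K b ^+ a
            - Xv K b (k - 4)%N%:Z * X0 K b ^+ (a + d))
  else if k == (8 - b)%N then tv K b * phi K b 2 2
  else if k == (9 - b)%N then tv K b * phi K b 1 2
  else if k == (10 - b)%N then tv K b * phi K b 1 1
  else mv K b k.

Definition sigma (f : S) : S := f \mPo [tuple sigma_img i | i < nv b].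
HB.instance Definition _ := GRing.RMorphism.copy sigma
  (comp_mpoly [tuple sigma_img i | i < nv b]).
HB.instance Definition _ := GRing.Linear.copy sigma
  (comp_mpoly [tuple sigma_img i | i < nv b]).

Lemma sigma_mv k : (k < nv b)%N -> sigma (mv K b k) = sigma_img k.
Proof.
move=> lt_k; rewrite /sigma /mv insubT comp_mpolyXU.
by rewrite -tnth_nth tnth_mktuple.
Qed.

Lemma sigmaE : (forall f g, sigma (f + g) = sigma f + sigma g)
  * (forall f g, sigma (f - g) = sigma f - sigma g)
  * (forall f, sigma (- f) = - sigma f)
  * (forall f g, sigma (f * g) = sigma f * sigma g)
  * (forall f k, sigma (f ^+ k) = sigma f ^+ k)
  * (sigma 0 = 0) * (sigma 1 = 1).
Proof.
do !split; [exact: rmorphD|exact: rmorphB|exact: rmorphN|exact: rmorphM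
  |by move=> f k; rewrite rmorphXn|exact: rmorph0|exact: rmorph1].
Qed.
End Substitution.

(** For numeral [b], every X, Psi and Phi becomes [mv] at a literal index or 0, so that [ring]
    recognises equal variables. *)
Ltac eval_atoms :=
  rewrite /X0 /X1 /X2 /X3 /tv /phi;
  repeat match goal with
  | |- context [Xv ?K ?b ?i] =>
     let j := eval vm_compute in i in
     lazymatch j with
     | Posz 0 => change (Xv K b i) with (mv K b 3)
     | Posz 1 => change (Xv K b i) with (mv K b 0)
     | Posz 2 => change (Xv K b i) with (mv K b 1)
     | Posz 3 => change (Xv K b i) with (mv K b 2)
     | _ => change (Xv K b i) with (0 : {mpoly K[nv b]})
     end
  | |- context [Psi ?K ?b ?i] =>
     let j := eval vm_compute in i in
     let m := eval vm_compute in (3 - b)%N in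
     lazymatch j with
     | Posz ?k => let t := eval vm_compute in (k <= m)%N in
        lazymatch t with
        | true => let v := eval vm_compute in (4 + k)%N in
                  change (Psi K b i) with (mv K b v)
        | false => change (Psi K b i) with (0 : {mpoly K[nv b]})
        end
     | _ => change (Psi K b i) with (0 : {mpoly K[nv b]})
     end
  | |- context [Phi ?K ?b ?i ?j] =>
     let i1 := eval vm_compute in i in
     let j1 := eval vm_compute in j in
     let k11 := eval vm_compute in (10 - b)%N in
     let k12 := eval vm_compute in (9 - b)%N in
     let k22 := eval vm_compute in (8 - b)%N in
     lazymatch constr:((i1, j1)) with
     | (Posz 1, Posz 1) => change (Phi K b i j) with (mv K b k11)
     | (Posz 1, Posz 2) => change (Phi K b i j) with (mv K b k12)
     | (Posz 2, Posz 1) => change (Phi K b i j) with (mv K b k12)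
     | (Posz 2, Posz 2) => change (Phi K b i j) with (mv K b k22)
     | _ => change (Phi K b i j) with (0 : {mpoly K[nv b]})
     end
  | |- context [mv ?K ?b (?x - ?y)%N] =>
     let k := eval vm_compute in (x - y)%N in change (mv K b (x - y)%N) with (mv K b k)
  end.

Ltac unfold_gen := rewrite /Ppoly /PPsi /Dpoly /Bpoly /Lpoly /Apoly /Mpoly /Q11 /Q12 /Q21.

(** The positive [a] is written [a.+1], which frees the exponents a - 1 and a + d - 1 of M and Q
    from truncated subtraction. *)
Lemma exponentE :
  (forall a, a.+1 + 1 = a.+2)%N * (forall a, a.+1 - 1 = a)%N * (forall a d, a.+1 + d - 1 = a + d)%N
  * (forall a d, a.+1 + d + 1 = (a + d).+2)%N * (forall a d, a.+1 + d = (a + d).+1)%N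
  * (forall a, 2 * a.+1 = (a + a).+2)%N.
Proof. by do !split=> *; lia. Qed.

Ltac expand_powers := rewrite ?exponentE ?exprS ?exprD ?expr0.

Ltac sigma0 := unfold_gen; eval_atoms; expand_powers; rewrite ?sigmaE;
  rewrite !sigma_mv // /sigma_img /=; eval_atoms; expand_powers; ring.

(** After substitution each case is a polynomial identity in t and the X_i. *)
Lemma sigma_GB K a d b : b \in [:: 1; 2; 3]%N ->
  forall g, g \in GB_ab K b a.+1 d -> sigma a.+1 d g = 0.
Proof.
move=> b_in g gG; apply/eqP; move: g gG; apply/allP; move: b_in.
rewrite !inE => /or3P [] /eqP -> {b}; rewrite /GB_ab /=;
  do ?[apply/andP; split=> //]; apply/eqP; sigma0.
Qed.

(** * Leading monomials *)

Section LeadMonomials.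
Variables (K : fieldType) (b a d : nat).
Notation S := {mpoly K[nv b]}.
Notation M := 'X_{1..nv b}.
Notation omega := (omega a (3 * a + b) d).
Notation gt := (mono_gtE b a (3 * a + b) d).

Definition lower (mu nu : M) : bool :=
  [&& gt mu nu, omega nu == omega mu & tau nu == tau mu].

(* Stronger than being a leading monomial: [g] is moreover bihomogeneous. *)
Definition has_lead (g : S) (mu : M) : Prop :=
  exists2 r, g = 'X_[mu] + r & forall nu, nu \in msupp r -> lower mu nu.

Lemma lead_mon mu : has_lead 'X_[mu] mu.
Proof. by exists 0 => [|nu]; rewrite ?addr0 // msupp0. Qed.

Lemma lead_add g mu nu : has_lead g mu -> lower mu nu -> has_lead (g + 'X_[nu]) mu.
Proof.
move=> [r -> Hr] low; exists (r + 'X_[nu]); first by rewrite addrA.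
by move=> x /msuppD_le; rewrite mem_cat msuppX inE => /orP[/Hr|/eqP->].
Qed.

Lemma lead_sub g mu nu : has_lead g mu -> lower mu nu -> has_lead (g - 'X_[nu]) mu.
Proof.
move=> [r -> Hr] low; exists (r - 'X_[nu]); first by rewrite addrA.
by move=> x /msuppB_le; rewrite mem_cat msuppX inE => /orP[/Hr|/eqP->].
Qed.

Lemma mv_mon k : (k < nv b)%N -> mv K b k = 'X_[mk b k].
Proof. by move=> lt_k; rewrite /mv /mk insubT. Qed.

Let t : M := mk b (11 - b).
Let psi j : M := mk b (4 + j).

(* Ppoly 2 1 and Bpoly 2 1 repeat Ppoly 1 2 and Bpoly 1 2. *)
Definition leads : seq (S * M) :=
  [:: (Ppoly K b 1 1, t + (mk b 0 + mk b 0))%MM; (Ppoly K b 1 2, t + (mk b 0 + mk b 1))%MM;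
      (Ppoly K b 2 2, t + (mk b 1 + mk b 1))%MM]
  ++ [seq (PPsi K b a d l%:Z, t + mk b (b + l).-1 + mk b 2 *+ a)%MM | l <- iota 0 (4 - b)]
  ++ (if b != 3%N then
        [seq (Mpoly K b a d j, t + mk b 3 *+ (a + d + 1) + psi j)%MM | j <- iota 0 (3 - b)]
      else [::])
  ++ [:: (Lpoly K b 0, mk b 3 + mk b (8 - b))%MM; (Lpoly K b 1, mk b 0 + mk b (8 - b))%MM]
  ++ [:: (Bpoly K b a d 1 1, mk b 0 + mk b 0 + psi (3 - b))%MM;
         (Bpoly K b a d 1 2, mk b 0 + mk b 1 + psi (3 - b))%MM;
         (Bpoly K b a d 2 2, mk b 1 + mk b 1 + psi (3 - b))%MM]
  ++ (if b != 3%N then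
        [seq (Apoly K b a d i%:Z j%:Z, mk b i.-1 + psi j)%MM
           | i <- [:: 1; 2; 3]%N, j <- iota 0 (3 - b)]
      else [::])
  ++ [:: (Dpoly K b, mk b 0 *+ 2 + mk b (9 - b))%MM]
  ++ (if b == 1%N then
        [:: (Q11 K b, psi 0 + mk b (8 - b))%MM; (Q12 K b a d, psi 1 *+ 2)%MM]
      else if b == 2%N then [:: (Q21 K b a d, psi 0 *+ 2 + mk b (8 - b))%MM]
      else [::]).
End LeadMonomials.

(** A boolean form of the comparison that [lia] can decide. *)
Lemma first_ltE x s y s' :
  first_lt (x :: s) (y :: s') = (x < y)%N || (x == y) && first_lt s s'.
Proof. by rewrite /=; case: ltngtP. Qed.

Ltac expand_terms :=
  rewrite ?(mulr0, mul0r, subr0, sub0r, addr0, add0r, oppr0)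
    ?(mulrDl, mulrDr, mulNr, mulrN, mul1r, mulr1, opprD, opprK, addrA).

(** With equal weights clause (ii) of the order never decides, so only the later clauses are
    tested. *)
Lemma lowerI b a d (mu nu : 'X_{1..nv b}) : b \in [:: 1; 2; 3]%N ->
  weight b a d (encode nu) = weight b a d (encode mu) -> tau nu = tau mu ->
  (tdeg nu < tdeg mu)%N || (tdeg mu == tdeg nu) &&
    [|| (sumn (beta nu) < sumn (beta mu))%N,
      (sumn (beta mu) == sumn (beta nu)) && rightmost_neg (beta mu) (beta nu),
      (beta mu == beta nu) && (sumn (gamma nu) < sumn (gamma mu))%N,
      [&& beta mu == beta nu, sumn (gamma mu) == sumn (gamma nu)
        & rightmost_neg (gamma mu) (gamma nu)] |
      [&& beta mu == beta nu, gamma mu == gamma nu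
        & rightmost_neg (alpha mu) (alpha nu)]] ->
  lower a d mu nu.
Proof.
move=> b_in Ew Et H; rewrite /lower Et !omegaE // Ew !eqxx !andbT.
rewrite /mono_gtE !omegaE // Ew !eqxx ltnn andbF /=.
by case/orP: H => [->|/andP[-> /= ->]] //; rewrite orbT.
Qed.

(** * Monomials as explicit exponent lists *)

Section ExponentVectors.
Variable b : nat.
Notation M := 'X_{1..nv b}.

Definition of_exps (s : seq nat) : M := [multinom nth 0%N s i | i < nv b].
Definition unit_exps (k : nat) : seq nat := [seq (j == k : nat) | j <- iota 0 (nv b)].
Definition add_exps (s s' : seq nat) : seq nat := [seq (p.1 + p.2)%N | p <- zip s s'].

Lemma ex_of_exps s k : (size s <= nv b)%N -> ex (of_exps s) k = nth 0%N s k.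
Proof.
move=> les; rewrite /ex; case: insubP => [i _ <-|]; first by rewrite mnmE.
by rewrite -leqNgt => lek; rewrite nth_default // (leq_trans les).
Qed.

Lemma mk_exps k : mk b k = of_exps (unit_exps k).
Proof.
apply: ex_inj => j lt_j; rewrite ex_of_exps ?size_map ?size_iota //.
rewrite (nth_map 0%N) ?size_iota // nth_iota // add0n.
have [lek|gtk] := ltnP k (nv b); first by rewrite ex_mk // eq_sym.
rewrite ltn_eqF ?(leq_trans lt_j) // /mk insubF 1?ltnNge ?gtk //.
by rewrite /ex; case: insubP => // i _ _; rewrite mnm0E.
Qed.

Lemma of_expsD s s' : size s = size s' ->
  (of_exps s + of_exps s')%MM = of_exps (add_exps s s').
Proof.
move=> ss; apply/mnmP => i; rewrite mnmDE !mnmE.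
have [lti|gei] := ltnP i (size s); last first.
  by rewrite !nth_default // ?size_map ?size_zip -?ss ?minnn.
by rewrite (nth_map (0%N, 0%N)) ?nth_zip // size_zip -ss minnn.
Qed.

Lemma of_expsMn s n : (of_exps s *+ n)%MM = of_exps [seq (x * n)%N | x <- s].
Proof.
apply/mnmP => i; rewrite mulmnE !mnmE; have [lti|gei] := ltnP i (size s).
  by rewrite (nth_map 0%N).
by rewrite !nth_default ?size_map.
Qed.

(** The local definitions repeat [encode], [beta], [gamma] and [alpha] on lists, so that for
    concrete lists everything computes to linear arithmetic. *)
Lemma lower_exps a d (s s' : seq nat) : b \in [:: 1; 2; 3]%N ->
  (size s <= nv b)%N -> (size s' <= nv b)%N ->
  let e := nth 0%N s in let e' := nth 0%N s' in
  let enc e := TFree (e 0) (e 1) (e 2) (e 3)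
    (if b <= 1 then e (5 - b) else 0)%N (if b <= 2 then e (6 - b) else 0)%N
    (e (7 - b)%N) (e (8 - b)%N) (e (9 - b)%N) (e (10 - b)%N) in
  let be e := [seq (e (4 + j) : nat) | j <- iota 0 (4 - b)]%N in
  let ga e := [:: e (8 - b); e (9 - b); e (10 - b)]%N : seq nat in
  let al e := [:: e 0; e 1; e 2; e 3]%N : seq nat in
  weight b a d (enc e') = weight b a d (enc e) ->
  (e' (11 - b) + tfdeg (enc e') = e (11 - b) + tfdeg (enc e))%N ->
  (e' (11 - b) < e (11 - b))%N || (e (11 - b) == e' (11 - b))%N &&
    [|| (sumn (be e') < sumn (be e))%N,
      (sumn (be e) == sumn (be e')) && rightmost_neg (be e) (be e'),
      (be e == be e') && (sumn (ga e') < sumn (ga e))%N,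
      [&& be e == be e', sumn (ga e) == sumn (ga e') & rightmost_neg (ga e) (ga e')] |
      [&& be e == be e', ga e == ga e' & rightmost_neg (al e) (al e')]] ->
  lower a d (of_exps s) (of_exps s').
Proof.
move=> b_in les les' e e' enc be ga al Ew Et H.
have Ee k : ex (of_exps s) k = e k by exact: ex_of_exps.
have Ee' k : ex (of_exps s') k = e' k by exact: ex_of_exps.
have En : encode (of_exps s) = enc e by rewrite /encode !Ee.
have En' : encode (of_exps s') = enc e' by rewrite /encode !Ee'.
have Eb : beta (of_exps s) = be e by apply: eq_map.
have Eb' : beta (of_exps s') = be e' by apply: eq_map.
have Eg : gamma (of_exps s) = ga e by rewrite /gamma !Ee.
have Eg' : gamma (of_exps s') = ga e' by rewrite /gamma !Ee'.
have Ea : alpha (of_exps s) = al e by rewrite /alpha !Ee.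
have Ea' : alpha (of_exps s') = al e' by rewrite /alpha !Ee'.
have Ed : tdeg (of_exps s) = e (11 - b)%N by rewrite /tdeg Ee.
have Ed' : tdeg (of_exps s') = e' (11 - b)%N by rewrite /tdeg Ee'.
by apply: lowerI => //; rewrite ?/tau ?En ?En' ?Ed ?Ed' ?Eb ?Eb' ?Eg ?Eg' ?Ea ?Ea'.
Qed.
End ExponentVectors.

Ltac to_exps :=
  rewrite !mk_exps ?of_expsMn; repeat (rewrite of_expsD //); rewrite /unit_exps /add_exps /=.

Ltac prove_lower :=
  to_exps; apply: lower_exps => //;
  rewrite /weight /tfdeg /mseq /rightmost_neg /rev /= -?first_ltE; lia.

Ltac prove_lead :=
  unfold_gen; eval_atoms; rewrite ?exponentE ?expr1 ?sqrrN ?expr1n; expand_terms;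
  rewrite !mv_mon // ?mpolyXn -?mpolyXD;
  repeat (first [apply: lead_add | apply: lead_sub]); [exact: lead_mon|..];
  prove_lower.

Lemma subseq_keep (T : eqType) (x : T) s t : subseq s t -> subseq (x :: s) (x :: t).
Proof. by rewrite /= eqxx. Qed.

Lemma subseq_skip (T : eqType) (x : T) s t : subseq s t -> subseq s (x :: t).
Proof. by move/subseq_trans; apply; exact: subseq_cons. Qed.

Local Arguments subseq : simpl never.

Lemma leads_GB K a d b : b \in [:: 1; 2; 3]%N ->
  forall p, p \in leads K b a d -> p.1 \in GB_ab K b a d.
Proof.
move=> b_in p /(map_f fst); apply: mem_subseq; rewrite /leads /GB_ab.
case/in123: b_in => -> /=.
all: do 2![apply: subseq_keep]; apply: subseq_skip; apply: subseq_keep.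
(* Between [Ppoly 2 2] and [Bpoly 2 1] stand 4 - b polynomials [PPsi], 3 - b polynomials M, two L
   and two B: 9, 7 or 5 entries. *)
- by do 9![apply: subseq_keep]; apply: subseq_skip; exact: subseq_refl.
- by do 7![apply: subseq_keep]; apply: subseq_skip; exact: subseq_refl.
- by do 5![apply: subseq_keep]; apply: subseq_skip; exact: subseq_refl.
Qed.

(** In every basis element the first term, as written and expanded, is the leading one; the others
    are peeled off from the right and compared with it. *)
Lemma leads_lead K a d b : b \in [:: 1; 2; 3]%N ->
  forall p, p \in leads K b a.+1 d -> has_lead a.+1 d p.1 p.2.
Proof.
case/in123=> -> p; rewrite /leads [iota _ _]/= [_ ++ _]/=.
all: repeat (case/predU1P => [->|]); try by [].
all: rewrite [X in has_lead _ _ X _]/= [X in has_lead _ _ _ X]/=.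
all: prove_lead.
Qed.

Lemma mon_divides_exps b (s : seq nat) (nu : 'X_{1..nv b}) : (size s <= nv b)%N ->
  mon_divides (of_exps b s) nu = all (fun k => nth 0 s k <= ex nu k)%N (iota 0 (nv b)).
Proof. by move=> les; rewrite mon_dividesE; apply: eq_all => k; rewrite ex_of_exps. Qed.

(** The P, [PPsi] and M give the clauses of [t_std], the t-free leading monomials those of
    [tfree_std]. *)
Lemma leads_cover K a d b : b \in [:: 1; 2; 3]%N -> forall nu,
  all (fun p => ~~ mon_divides p.2 nu) (leads K b a d) ->
  tfree_std b (encode nu) && ((0 < tdeg nu)%N ==> t_std b a d (encode nu)).
Proof.
case/in123=> -> nu; rewrite /leads /=.
all: rewrite !mk_exps ?of_expsMn; repeat (rewrite of_expsD //).
all: rewrite !mon_divides_exps //.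
all: rewrite /unit_exps /add_exps [iota _ _]/=; simpl.
all: rewrite ?(add0n, addn0, mul0n, mul1n) /= ?andbT.
all: rewrite /tfree_std /t_std /tdeg /encode; simpl; eval_ex.
all: move: (ex nu 0) (ex nu 1) (ex nu 2) (ex nu 3) (ex nu 4) (ex nu 5).
all: move: (ex nu 6) (ex nu 7) (ex nu 8) (ex nu 9) (ex nu 10).
(* Splitting the exponents of t, Phi and Psi into zero and successor settles most divisibility tests
   by computation. *)
all: move=> [|e6] [|e7] [|e8] [|e9] [|e10] e0 e1 e2 e3 [|e4] [|e5] /=; rewrite ?andbF ?andbT /=.
all: try by [].
all: lia.
Qed.

(** * Assembling the Groebner basis *)

Section Ideal.
Variables (K : fieldType) (n : nat) (gens : seq {mpoly K[n]}).
Notation I := (in_ideal gens).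

Lemma in_ideal0 : I 0.
Proof. by exists (fun=> 0); rewrite big1 // => i _; rewrite mul0r. Qed.

Lemma in_idealD f g : I f -> I g -> I (f + g).
Proof.
move=> [c ->] [c' ->]; exists (fun i => c i + c' i); rewrite -big_split /=.
by apply: eq_bigr => i _; rewrite mulrDl.
Qed.

Lemma in_idealM p f : I f -> I (p * f).
Proof.
move=> [c ->]; exists (fun i => p * c i); rewrite mulr_sumr.
by apply: eq_bigr => i _; rewrite mulrA.
Qed.

Lemma in_idealN f : I f -> I (- f).
Proof. by rewrite -mulN1r; exact: in_idealM. Qed.

Lemma in_ideal_mem g : g \in gens -> I g.
Proof.
move=> g_in; exists (fun i => (i == index g gens)%:R).
have lt_g : (index g gens < size gens)%N by rewrite index_mem.
rewrite (bigD1 (Ordinal lt_g)) //= eqxx mul1r nth_index // big1 ?addr0 // => i ne.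
by rewrite -val_eqE /= in ne; rewrite (negPf ne) mul0r.
Qed.

(* Congruence modulo an ideal is compatible with substitution. *)
Lemma in_ideal_comp (lq : n.-tuple {mpoly K[n]}) :
  (forall i, I ('X_i - tnth lq i)) -> forall f, I (f - (f \mPo lq)).
Proof.
move=> Hlq f.
have congM p q p' q' : I (p - p') -> I (q - q') -> I (p * q - p' * q').
  move=> Ip Iq; have -> : p * q - p' * q' = q * (p - p') + p' * (q - q') by ring.
  by apply: in_idealD; apply: in_idealM.
have congX m : I ('X_[m] - ('X_[m] \mPo lq)).
  rewrite comp_mpolyX mpolyXE_id.
  apply: (big_ind2 (fun p q => I (p - q))) => [||i _].
  - by rewrite subrr; exact: in_ideal0.
  - by move=> p p' q q'; exact: congM.
  elim: (m i) => [|k IHk]; first by rewrite !expr0 subrr; exact: in_ideal0.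
  by rewrite !exprS; apply: congM.
elim/mpolyind: f => [|c m p _ _ IHp]; first by rewrite comp_mpoly0 subrr; exact: in_ideal0.
rewrite comp_mpolyD comp_mpolyZ opprD addrACA; apply: in_idealD => //.
by rewrite -scalerBr -mul_mpolyC; exact: in_idealM.
Qed.
End Ideal.

Lemma lead_mon_exists (K : fieldType) n (gt : rel 'X_{1..n}) (f : {mpoly K[n]}) :
  transitive gt -> (forall mu nu, mu != nu -> gt mu nu || gt nu mu) ->
  f != 0 -> exists mu, is_lead_mon gt f mu.
Proof.
move=> gt_trans gt_total; rewrite -msupp_eq0 /is_lead_mon.
elim: (msupp f) => // x s IHs _; have [->|/IHs[mu [mu_s lead_mu]]] := eqVneq s [::].
  by exists x; split=> [|nu]; rewrite inE // => /eqP->; rewrite eqxx.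
have [Exm|nxm] := eqVneq x mu.
  by exists mu; rewrite inE mu_s orbT; split=> // nu; rewrite inE => /predU1P[->|/lead_mu//]; rewrite Exm eqxx.
have [gtx|gtx] := orP (gt_total _ _ nxm); last first.
  exists mu; rewrite inE mu_s orbT; split=> // nu.
  by rewrite inE => /predU1P[->//|/lead_mu].
exists x; rewrite inE eqxx; split=> // nu; rewrite inE => /predU1P[->|nus _].
  by rewrite eqxx.
by have [->//|/(lead_mu _ nus)] := eqVneq nu mu; exact: gt_trans.
Qed.

(** * The ideal as the kernel of the substitution *)

Lemma tfdeg0_ex b : b \in [:: 1; 2; 3]%N -> forall (nu : 'X_{1..nv b}) k,
  tfdeg (encode nu) = 0%N -> (4 <= k < 11 - b)%N -> ex nu k = 0%N.
Proof.
case/in123=> -> nu k; rewrite /tfdeg /encode /=; eval_ex => nu0.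
all: do 10? [case: k => [|k] //=; try by move: nu0; lia].
Qed.

Section Kernel.
Variables (K : fieldType) (b a d : nat).
Notation S := {mpoly K[nv b]}.
Hypothesis b_in : b \in [:: 1; 2; 3]%N.
Notation gens := (gens_ab K b a.+1 d).
Notation sigma := (@sigma K b a.+1 d).

Lemma gens_GB g : g \in gens -> g \in GB_ab K b a.+1 d.
Proof. by rewrite /gens_ab /GB_ab !mem_cat => /orP[->|->]; rewrite ?orbT. Qed.

Lemma sigma_ideal f : in_ideal gens f -> sigma f = 0.
Proof.
move=> [c ->]; rewrite (linear_sum sigma) big1 // => i _.
change (sigma (c i * gens`_i) = 0).
rewrite sigmaE (sigma_GB b_in (gens_GB (mem_nth 0 (ltn_ord i)))).
exact: mulr0.
Qed.

(** For Phi and Psi the difference is, up to sign, one of the generators; for t and the X_i it is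
    0. *)
Lemma mv_sigma_img k : in_ideal gens (mv K b k - sigma_img K b a.+1 d k).
Proof.
have memP i j : Ppoly K b i j \in gens -> in_ideal gens (Phi K b i j - tv K b * phi K b i j).
  by move=> /in_ideal_mem/in_idealN; rewrite opprB.
rewrite /sigma_img; case: ifP => [/andP[k4 kb]|_].
  have -> : mv K b k = Psi K b (k - 4)%N%:Z.
    by rewrite /Psi /= subnKC // ifT //; lia.
  rewrite mulrBr !mulrA -opprB; apply: in_idealN; apply: in_ideal_mem.
  rewrite mem_cat; apply/orP; right; apply/mapP; exists (k - 4)%N => //.
  by rewrite mem_iota; lia.
case: eqP => [->|_]; first by apply: (memP 2 2); rewrite !inE eqxx !orbT.
case: eqP => [->|_]; first by apply: (memP 1 2); rewrite !inE eqxx !orbT.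
case: eqP => [->|_]; first by apply: (memP 1 1); rewrite !inE eqxx.
by rewrite subrr; exact: in_ideal0.
Qed.

(** Modulo the ideal every variable, hence [f], is congruent to its image. *)
Lemma ideal_sigma f : sigma f = 0 -> in_ideal gens f.
Proof.
move=> sf; rewrite -[f]subr0 -sf; apply: in_ideal_comp => i.
have -> : 'X_i = mv K b i by rewrite /mv valK.
by rewrite tnth_mktuple; exact: mv_sigma_img.
Qed.

Lemma sigma_target (nu : 'X_{1..nv b}) :
  tfdeg (encode nu) = 0%N -> sigma 'X_[nu] = 'X_[nu].
Proof.
move=> nu0; rewrite [LHS]comp_mpolyX mpolyXE_id; apply: eq_bigr => i _.
rewrite tnth_mktuple; have [->|nz] := eqVneq (nu i) 0%N; first by rewrite !expr0.
have -> : 'X_i = mv K b i by rewrite /mv valK.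
have notin : ~~ (4 <= i < 11 - b)%N.
  by apply: contra nz => /(tfdeg0_ex b_in nu0); rewrite exE => ->.
by rewrite /sigma_img !ifF //; move: b_in notin; rewrite !inE; lia.
Qed.

End Kernel.

(** * The two gradings *)

Lemma encode_inj b : b \in [:: 1; 2; 3]%N -> forall mu nu : 'X_{1..nv b},
  tdeg mu = tdeg nu -> encode mu = encode nu -> mu = nu.
Proof.
case/in123=> -> mu nu; rewrite /tdeg /encode /=; eval_ex => Et [] *; apply: ex_inj;
  rewrite /nv; do 11? (case; first lia); move=> k; lia.
Qed.

Lemma tauD b (mu nu : 'X_{1..nv b}) : tau (mu + nu)%MM = (tau mu + tau nu)%N.
Proof. by rewrite /tau /tdeg /tfdeg /encode /= !exD; do 2![case: ifP => _]; lia. Qed.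

Section Gradings.
Variables (b a d : nat).
Notation M := 'X_{1..nv b}.
Hypothesis b_in : b \in [:: 1; 2; 3]%N.
Notation omega := (@omega b a (3 * a + b) d).

Lemma omegaD (mu nu : M) : omega (mu + nu)%MM = (omega mu + omega nu)%N.
Proof.
by rewrite !omegaE // /weight /encode /= !exD; do 2![case: ifP => _]; lia.
Qed.

Lemma mdeg_ex (mu : M) : mdeg mu = \sum_(k <- iota 0 (nv b)) ex mu k.
Proof.
rewrite mdegE -[nv b in RHS]subn0 -/(index_iota _ _) big_mkord.
by apply: eq_bigr => i _; rewrite exE.
Qed.

(** [tau] counts t, Phi and Psi, and each X_i has positive weight; hence only finitely many
    monomials have bounded bidegree. *)
Lemma mdeg_le (mu : M) : (mdeg mu <= tau mu + omega mu)%N.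
Proof.
have le_w : (x1 (encode mu) + x2 (encode mu) + x3 (encode mu) + x0 (encode mu) <= omega mu)%N.
  rewrite omegaE // /weight; set w := (_ + (mseq _ _ 0) * _)%N.
  have m_gt0 i : (0 < mseq (3 * a + b) d i)%N.
    by move: b_in; rewrite !inE /mseq; lia.
  have : (x1 (encode mu) + x2 (encode mu) + x3 (encode mu) + x0 (encode mu) <= w)%N.
    by rewrite !leq_add // leq_pmull.
  lia.
rewrite mdeg_ex; apply: leq_trans (leq_add (leqnn _) le_w).
rewrite /tau /tdeg /tfdeg /encode; case/in123: b_in => E; move: mu {le_w}; rewrite E unlock /= => mu;
  eval_ex; lia.
Qed.

Lemma encode_decode k u : tfdeg u = 0%N -> encode (decode b k u) = u.
Proof.
case: u => x1 x2 x3 x0 [|//] [|//] [|//] [|//] [|//] [|//] _.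
rewrite /encode /decode /= !(exMn, exD).
by case/in123: b_in => -> /=; rewrite !ex_mk //= ?mul1n ?addn0 ?add0n.
Qed.

Lemma tdeg_decode k u : tdeg (decode b k u) = k.
Proof.
rewrite /tdeg /decode !(exMn, exD).
by case/in123: b_in => -> /=; rewrite !ex_mk //= mul1n.
Qed.
End Gradings.

(** * Standard monomials of S *)

Section StandardInjection.
Variables (K : fieldType) (b a d : nat).
Notation S := {mpoly K[nv b]}.
Notation M := 'X_{1..nv b}.
Hypothesis b_in : b \in [:: 1; 2; 3]%N.
Notation sigma := (@sigma K b a.+1 d).
Notation omega := (@omega b a.+1 (3 * a.+1 + b) d).
Notation gt := (mono_gtE b a.+1 (3 * a.+1 + b) d).

Lemma has_lead_is_lead (g : S) mu : has_lead a.+1 d g mu -> is_lead_mon gt g mu.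
Proof.
move=> [r -> Hr]; have mu_r : mu \notin msupp r.
  by apply/negP => /Hr/and3P[]; rewrite gt_irr.
split; first by rewrite mcoeff_msupp mcoeffD mcoeffX eqxx (memN_msupp_eq0 mu_r) addr0 oner_eq0.
move=> nu /msuppD_le; rewrite mem_cat msuppX inE => /orP[->//|/Hr/and3P[]//].
Qed.

Definition standard (mu : M) : bool :=
  tfree_std b (encode mu) && ((0 < tdeg mu)%N ==> t_std b a.+1 d (encode mu)).

(** One division step: a multiple of a basis element, which [sigma] kills, has leading monomial
    [nu]. Multiplication respects the order and both gradings. *)
Lemma nonstandard_reduces nu : ~~ standard nu ->
  exists2 r, sigma 'X_[nu] = sigma r & forall x, x \in msupp r -> lower a.+1 d nu x.
Proof.
rewrite /standard => /(contra (@leads_cover K _ _ _ b_in _))/allPn[[g mu] gl].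
rewrite negbK /= => div; have sg := sigma_GB b_in (leads_GB b_in gl).
have [r Eg Hr] := leads_lead b_in gl; rewrite /= in sg Eg Hr.
pose xi := (nu - mu)%MM; have Enu : nu = (mu + xi)%MM.
  by apply/mnmP => i; rewrite mnmDE mnmBE subnKC //; exact: (forallP div).
exists (- (r * 'X_[xi])).
  have sigma_add f h : sigma (f + h) = sigma f + sigma h by rewrite sigmaE.
  have Er : sigma 'X_[mu] = - sigma r.
    by apply/eqP; rewrite -addr_eq0 -sigma_add -Eg sg.
  by rewrite Enu mpolyXD !sigmaE Er mulNr.
move=> x; rewrite (perm_mem (msuppN _)) => /msuppM_le/allpairsP[[y z] /= [yr]].
rewrite msuppX inE => /eqP-> ->; rewrite Enu /lower !(omegaD _ _ b_in) !tauD.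
by have /and3P[gty /eqP-> /eqP->] := Hr _ yr; rewrite !eqxx andbT gt_add.
Qed.

(** An element of the kernel need not be bihomogeneous, so all bidegrees up to N are taken together;
    [mdeg_le] bounds the total degree by N + N. *)
Definition bounded (N : nat) : seq M :=
  [seq mu <- [seq bmnm x | x <- enum {: 'X_{1..(nv b) < (N + N).+1}}] | (tau mu <= N) && (omega mu <= N)]%N.

Lemma mem_bounded N mu : (mu \in bounded N) = (tau mu <= N)%N && (omega mu <= N)%N.
Proof.
rewrite mem_filter andb_idr // => /andP[tN oN].
have lt_mu : (mdeg mu < (N + N).+1)%N.
  by rewrite ltnS (leq_trans (mdeg_le a.+1 d b_in mu)) // leq_add.
by apply/mapP; exists (BMultinom lt_mu); rewrite ?mem_enum.
Qed.

Definition flatten_mon (mu : M) : M := decode b (tau mu) (collapse b a.+1 d (encode mu)).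

Lemma flatten_mon_grading mu : standard mu ->
  [/\ tfdeg (encode (flatten_mon mu)) = 0%N, tau (flatten_mon mu) = tau mu
    & omega (flatten_mon mu) = omega mu].
Proof.
move=> /andP[su _]; have [_ d0 Ew] := collapse_std a.+1 d b_in su.
have Ee : encode (flatten_mon mu) = collapse b a.+1 d (encode mu) by exact: encode_decode.
have Ed : tdeg (flatten_mon mu) = tau mu by exact: tdeg_decode.
by rewrite !omegaE // Ee d0; split=> //; rewrite [LHS]/tau Ed Ee d0 addn0.
Qed.

Lemma flatten_mon_inj : {in standard &, injective flatten_mon}.
Proof.
move=> mu nu /andP[su tu] /andP[sv tv] E.
have [_ du _] := collapse_std a.+1 d b_in su; have [_ dv _] := collapse_std a.+1 d b_in sv.
have Et := congr1 (@tdeg b) E; rewrite !tdeg_decode // in Et.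
have Ee := congr1 (@encode b) E; rewrite !encode_decode // in Ee.
by have [] := collapse_inj b_in su sv tu tv Et Ee; exact: encode_inj.
Qed.

Lemma lead_mon_kernel f mu : sigma f = 0 -> is_lead_mon gt f mu -> ~~ standard mu.
Proof.
move=> sf lead_f; pose N := \max_(x <- msupp f) maxn (tau x) (omega x).
apply: (@lead_mon_nonstd _ _ _ (@gt_irr _ _ _) (@gt_trans _ _ _) sigma (bounded N) standard
  [pred x | tfdeg (encode x) == 0%N] flatten_mon) sf _ lead_f.
- move=> nu; rewrite mem_bounded => /andP[tN oN] /nonstandard_reduces[r Er Hr].
  exists r => // x /Hr/and3P[gtx /eqP Eo /eqP Et].
  by rewrite mem_bounded Eo Et tN oN gtx.
- by move=> nu /eqP; exact: sigma_target.
- move=> nu; rewrite !mem_bounded => /andP[tN oN] /flatten_mon_grading[/= -> -> ->].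
  by rewrite tN oN eqxx.
- by move=> x y /andP[_ sx] /andP[_ sy]; exact: flatten_mon_inj.
- move=> x xf; rewrite mem_bounded -geq_max.
  by rewrite /N (big_rem x) //= leq_maxl.
Qed.
End StandardInjection.

Theorem theorem5p1 (K : fieldType) (m0 d a b : nat) :
  (0 < m0)%N -> (0 < d)%N ->
  gcdn (gcdn (mseq m0 d 0) (mseq m0 d 1)) (gcdn (mseq m0 d 2) (mseq m0 d 3)) = 1%N ->
  minimally_generating (mseq m0 d) ->
  (1 <= a)%N -> b \in [:: 1%N; 2%N; 3%N] -> m0 = (3 * a + b)%N ->
  is_groebner_basis (mono_gtE b a m0 d) (GB_ab K b a d) (gens_ab K b a d).
Proof.
move=> _ _ _ _; case: a => // a _ b_in ->; split=> [g gG|f /(sigma_ideal b_in) sf fn0].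
  by apply: ideal_sigma => //; exact: sigma_GB.
have [mu lead_f] := lead_mon_exists (@gt_trans b a.+1 d) (@gt_total b a.+1 d b_in) fn0.
have := lead_mon_kernel b_in sf lead_f.
(* As [mu] is not standard, some monomial listed in [leads] divides it. *)
move=> /(contra (@leads_cover K _ _ _ b_in _))/allPn[[g nu] gl]; rewrite negbK /= => div.
exists g, mu, nu; split=> //; first exact: (leads_GB b_in gl).
exact: has_lead_is_lead (leads_lead b_in gl).
Qed.
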